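(* Let $T$ be a tree that is not a path. Then $o(T)=\mathcal{S}$ if $|N(v)\cap L_v|\geq 4$ for some $v\in M_2(T)$, or $|N(u)\cap L_u|=3=|N(w)\cap L_w|$ for distinct $u,w\in M_2(T)$; $o(T)=\mathcal{N}$ if $|N(w)\cap L_w|=3$ for exactly one $w\in M_2(T)$ and $|N(v)\cap L_v|\leq 2$ for each $v\in M_2(T)\setminus\{w\}$; and $o(T)=\mathcal{R}$ if $|N(v)\cap L_v|\leq 2$ for each $v\in M_2(T)$. Moreover, if $o(T)=\mathcal{S}$ then $S_{\rm MB}(T)=S'_{\rm MB}(T)=2$, and if $o(T)=\mathcal{R}$ then $R_{\rm MB}(T)=R'_{\rm MB}(T)=\dim(T)=\sigma(T)-ex(T)$.
   Context: In a tree $T$, $N(v)$ is the open neighborhood of $v$. A major vertex is a vertex of degree at least $3$. A degree-one vertex $\ell$ is a terminal vertex of a major vertex $v$ if $d(\ell,v)<d(\ell,w)$ for every other major vertex $w$. The terminal degree $ter(v)$ is the number of terminal vertices of $v$; an exterior major vertex is a major vertex with positive terminal degree. $ex(T)$ is the number of exterior major vertices, $\sigma(T)$ the number of leaves, $M(T)$ the set of exterior major vertices, $M_2(T)=\{w\in M(T): ter(w)\geq 2\}$, and $L_v$ is the set of terminal vertices of $v$. A resolving set is $W\subseteq V(T)$ such that for all distinct $x,y$ some $z\in W$ has $d(x,z)\neq d(y,z)$; $\dim(T)$ is the minimum size of a resolving set. In the Maker-Breaker resolving game, Resolver and Spoiler alternately select (without skipping) a not-yet-selected vertex; Resolver wins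 if at some point his vertices form a resolving set, otherwise Spoiler wins. R-game: Resolver moves first; S-game: Spoiler moves first. $o(T)=\mathcal{R}$ (resp. $\mathcal{S}$) if Resolver (resp. Spoiler) has a winning strategy in both games; $o(T)=\mathcal{N}$ if the first player has a winning strategy in each game. $R_{\rm MB}$, $R'_{\rm MB}$ are the minimum numbers of moves Resolver needs to win the R-game, resp. S-game, and $S_{\rm MB}$, $S'_{\rm MB}$ the minimum numbers of moves Spoiler needs to win the R-game, resp. S-game (each $\infty$ if that player has no winning strategy). *)

(* Defs.v *)
From HB Require Import structures.
From mathcomp Require Import all_boot.
From mathcomp Require Import boolp.

Set Implicit Arguments.
Unset Strict Implicit.
Unset Printing Implicit Defensive.

(* The minimum of a set of natural numbers; None stands for infinity, the
   minimum of the empty set. *)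
Definition least (P : nat -> Prop) : option nat :=
  if pselect (exists n, `[< P n >]) is left h then Some (ex_minn h) else None.

Section Graph.
Variables (T : finType) (e : rel T).

Definition is_tree : Prop :=
  [/\ symmetric e, irreflexive e, 0 < #|T|,
      forall x y, connect e x y
    & forall c : seq T, 2 < size c -> ~ ucycle e c].

Definition is_path_graph : Prop :=
  exists n (f : 'I_n -> T), bijective f /\
    forall i j, e (f i) (f j) = (i.+1 == j) || (j.+1 == i).

(* The length of a shortest walk from x to y; #|T| if there is no walk. *)
Definition dist (x y : T) : nat :=
  find (fun n => [exists p : n.-tuple T, path e x p && (last x p == y)])
       (iota 0 #|T|).

Definition nbh (v : T) : {set T} := [set w | e v w].
Definition deg (v : T) : nat := #|nbh v|.
Definition major (v : T) : bool := 3 <= deg v.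

Definition terminal (l v : T) : bool :=
  [&& deg l == 1, major v &
      [forall w, major w && (w != v) ==> (dist l v < dist l w)]].

Definition term_set (v : T) : {set T} := [set l | terminal l v].
Definition ter (v : T) : nat := #|term_set v|.
Definition ext_major : {set T} := [set v | major v & 0 < ter v].
Definition ext_major2 : {set T} := [set v in ext_major | 2 <= ter v].
Definition ex_num : nat := #|ext_major|.
Definition leaf_num : nat := #|[set l | deg l == 1]|.

Definition resolving (W : {set T}) : bool :=
  [forall x, forall y, (x != y) ==> [exists z in W, dist x z != dist y z]].

Definition metric_dim : nat :=
  #|[arg min_(W < [set: T] | resolving W) #|W| ]|.

End Graph.

Variant player := Resolver | Spoiler.

Definition opponent (pl : player) : player :=
  if pl is Resolver then Spoiler else Resolver.
Definition bool_of_player (pl : player) : bool :=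
  if pl is Resolver then true else false.
Definition player_of_bool (b : bool) : player :=
  if b then Resolver else Spoiler.
Lemma bool_of_playerK : cancel bool_of_player player_of_bool.
Proof. by case. Qed.
HB.instance Definition _ := Equality.copy player (can_type bool_of_playerK).

Variant outcome := OutcomeR | OutcomeS | OutcomeN.

(* A history is the duplicate-free sequence of the vertices selected so far by
   both players, in order.  Play is continued until all vertices have been
   selected; this is harmless, as whether a player has won is read off the
   prefixes of the play. *)
Section Game.
Variables (T : finType) (e : rel T) (first : player).

Definition turn (n : nat) : player := if odd n then opponent first else first.

Definition chosen (pl : player) (h : seq T) : {set T} :=
  [set x in h | turn (index x h) == pl].

Definition strategy := seq T -> T.

Definition legal_strategy (s : strategy) : Prop :=
  forall h, uniq h -> size h < #|T| -> s h \notin h.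

Definition complete_play (p : seq T) : Prop := uniq p /\ size p = #|T|.

Definition follows (pl : player) (s : strategy) (p : seq T) : Prop :=
  forall h x, prefix (rcons h x) p -> turn (size h) = pl -> x = s h.

Definition resolver_wins (p : seq T) : Prop :=
  exists2 h, prefix h p & resolving e (chosen Resolver h).

Definition wins (pl : player) (p : seq T) : Prop :=
  if pl is Resolver then resolver_wins p else ~ resolver_wins p.

Definition has_winning_strategy (pl : player) : Prop :=
  exists2 s, legal_strategy s &
    forall p, complete_play p -> follows pl s p -> wins pl p.

(* Resolver has won once his vertices form a resolving set; Spoiler has won
   once his vertices meet every resolving set, so that Resolver can no longer
   complete one. *)
Definition has_won (pl : player) (h : seq T) : Prop :=
  if pl is Resolver then resolving e (chosen Resolver h)
  else forall W, resolving e W -> ~~ [disjoint W & chosen Spoiler h].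

Definition wins_within (pl : player) (k : nat) : Prop :=
  exists2 s, legal_strategy s &
    forall p, complete_play p -> follows pl s p ->
      exists h, [/\ prefix h p, #|chosen pl h| <= k & has_won pl h].

Definition moves_to_win (pl : player) : option nat := least (wins_within pl).

End Game.

Section Invariants.
Variables (T : finType) (e : rel T).

Definition has_outcome (o : outcome) : Prop :=
  match o with
  | OutcomeR => has_winning_strategy e Resolver Resolver /\
                has_winning_strategy e Spoiler Resolver
  | OutcomeS => has_winning_strategy e Resolver Spoiler /\
                has_winning_strategy e Spoiler Spoiler
  | OutcomeN => has_winning_strategy e Resolver Resolver /\
                has_winning_strategy e Spoiler Spoiler
  end.

(* The R-game is the game with first player Resolver; the primed invariants
   refer to the S-game, with first player Spoiler. *)
Definition R_MB : option nat := moves_to_win e Resolver Resolver.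
Definition R_MB' : option nat := moves_to_win e Spoiler Resolver.
Definition S_MB : option nat := moves_to_win e Resolver Spoiler.
Definition S_MB' : option nat := moves_to_win e Spoiler Spoiler.

End Invariants.

(* Main.v *)
(* A tree that is not a path has a major vertex, and every leaf l is terminal at
   exactly one major vertex v; its leg is the path from l to v without v.  A set
   is resolving iff, at each major vertex, it misses at most one leg: the
   neighbours of v on two missed legs are twins for the set, and conversely two
   vertices which the set does not distinguish lie in two missed branches at
   their midpoint, while a branch containing a major vertex contains two legs at
   a common vertex.  So dim is at least the number of leaves minus the number of
   exterior major vertices.

   Legs of length one at v are the leaves adjacent to v, any two of which are
   twins; Spoiler wins by taking two of them.  Resolver spares one leg at each
   exterior major vertex (one of length one if possible) and has to meet the
   other legs.  A leg of length at least two contains two vertices, and a leg of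
   length one can be merged with a spared leg of length one; as long as at most
   two leaves are adjacent to v this yields disjoint blocks of size at least
   two, one for each leaf that is not spared, and Resolver meets a new block in
   every move. *)

Require Import Defs.
From mathcomp Require Import all_boot boolp zify.

Set Implicit Arguments.
Unset Strict Implicit.
Unset Printing Implicit Defensive.

(** * Distances and branches in a tree *)

Section TreeMetric.
Variables (T : finType) (e : rel T).
Hypothesis tree_e : is_tree e.

Local Notation d := (dist e).
Implicit Types a b c l r u v w x y z : T.

Let e_sym : symmetric e. Proof. by case: tree_e. Qed.
Let e_irr : irreflexive e. Proof. by case: tree_e. Qed.
Let e_conn x y : connect e x y. Proof. by case: tree_e. Qed.

Lemma dist_le_path x p : path e x p -> d x (last x p) <= size p.
Proof.
(* A walk with at least [#|T|] edges is covered at once, since [find] never exceeds the length of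
   the list it searches. *)
move=> ep; have [lt_pT|] := ltnP (size p) #|T|; last first.
  by apply: leq_trans; rewrite -[X in _ <= X](size_iota 0); exact: find_size.
rewrite leqNgt; apply/negP => /(before_find 0).
rewrite nth_iota // add0n => /existsP[].
by exists (in_tuple p); rewrite ep eqxx.
Qed.

(** By connectedness there is a walk, and removing its loops leaves fewer than [#|T|] edges; so the
    default value of [dist] never occurs. *)
Lemma dist_ltn x y : d x y < #|T|.
Proof.
rewrite -[X in _ < X](size_iota 0) -has_find; apply/hasP.
have /connectP[p ep ->] := e_conn x y.
have [q eq uq _] := shortenP ep.
have lt_qT : size q < #|T| by have := max_card (mem (x :: q)); rewrite (card_uniqP uq).
exists (size q); first by rewrite mem_iota.
by apply/existsP; exists (in_tuple q); rewrite eq eqxx.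
Qed.

Lemma dist_path x y :
  exists p, [/\ path e x p, last x p = y & size p = d x y].
Proof.
have := dist_ltn x y; rewrite -[X in _ < X](size_iota 0) -has_find => h.
have := nth_find 0 h; rewrite nth_iota ?add0n; last first.
  by rewrite -[X in _ < X](size_iota 0) -has_find.
case/existsP=> p /andP[ep /eqP lp]; exists p; split=> //.
by rewrite size_tuple.
Qed.

Lemma distxx x : d x x = 0.
Proof. by apply/eqP; rewrite -leqn0; apply: (@dist_le_path x [::]). Qed.

Lemma dist_eq0 x y : (d x y == 0) = (x == y).
Proof.
apply/eqP/eqP => [d0|->]; last exact: distxx.
by case: (dist_path x y) => [[|a p] [_ //]]; rewrite d0.
Qed.

Lemma dist_triangle y x z : d x z <= d x y + d y z.
Proof.
have [p [ep lp <-]] := dist_path x y; have [q [eq lq <-]] := dist_path y z.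
rewrite -size_cat -lq -{1}lp -last_cat; apply: dist_le_path.
by rewrite cat_path ep lp.
Qed.

Lemma dist_sym x y : d x y = d y x.
Proof.
have le a b : d b a <= d a b.
  have [p [ep lp <-]] := dist_path a b.
  have /dist_le_path : path e (last a p) (rev (belast a p)).
    by rewrite rev_path (eq_path (e' := e)) // => ? ?; exact: e_sym.
  suff -> : last (last a p) (rev (belast a p)) = a by rewrite size_rev size_belast lp.
  by case: (p) => //= b' q; rewrite rev_cons last_rcons.
by apply/eqP; rewrite eqn_leq !le.
Qed.

Lemma dist_edge x y : e x y -> d x y = 1.
Proof.
move=> exy; apply/eqP; rewrite eqn_leq lt0n dist_eq0.
have -> : x != y by apply: contraTneq exy => ->; rewrite e_irr.
by rewrite andbT (@dist_le_path x [:: y]) //= exy.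
Qed.

Lemma dist1_edge x y : d x y = 1 -> e x y.
Proof.
by have [[|a [|b p]] [/= ep <- <-]] // := dist_path x y; case/andP: ep.
Qed.

Lemma closer_neighbor x v :
  x != v -> exists2 u, e v u & d x v = (d x u).+1.
Proof.
have [p [ep lp sp]] := dist_path x v; move: ep lp sp.
case/lastP: p => [_ /= -> _|p a]; first by rewrite eqxx.
rewrite rcons_path last_rcons size_rcons => /andP[ep ea] <- sp _.
exists (last x p); first by rewrite e_sym.
have := dist_le_path ep; have := dist_triangle (last x p) x a.
rewrite (dist_edge ea); idtac; lia.
Qed.

(** Walk from [a] to [x] along closer neighbours: after [a], all distances to [x] are strictly below
    [d x v], so the walk avoids [v]. *)
Lemma closer_connect v x a :
  a != v -> d x a <= d x v ->
  connect [rel b c | [&& e b c, b != v & c != v]] a x.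
Proof.
move: {2}(d x a) (erefl (d x a)) => n; elim: n a => [|n IH] a.
  by move/eqP; rewrite dist_eq0 => /eqP->.
move=> dn av le_av; have xa: x != a by rewrite -dist_eq0 dn.
have [b eab db] := closer_neighbor xa.
have bv: b != v by apply: contraTneq le_av => <-; lia.
apply: connect_trans (IH b _ bv _); [|lia|lia].
by apply: connect1; rewrite /= eab av bv.
Qed.

(* Two such neighbours would be joined through x by a path avoiding v, which
   closes up to a cycle through v. *)
Lemma closer_neighbor_uniq x v u u' :
  x != v -> e v u -> e v u' -> d x u <= d x v -> d x u' <= d x v -> u = u'.
Proof.
move=> xv evu evu' le_u le_u'; apply/eqP; apply/negPn/negP => uu'.
have nv a : e v a -> a != v by apply: contraTneq => ->; rewrite e_irr.
set r := [rel b c | [&& e b c, b != v & c != v]].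
have r_sym : symmetric r by move=> b c; rewrite /= e_sym; congr (_ && _); rewrite andbC.
have : connect r u u'.
  apply: connect_trans (closer_connect (nv _ evu) le_u) _.
  by rewrite (sym_connect_sym r_sym) closer_connect ?nv.
case/connectP=> p rp; have [q rq uq _ lq] := shortenP rp.
have eq : path e u q by apply: sub_path rq => b c /andP[].
have vq : v \notin u :: q.
  rewrite inE eq_sym negb_or nv //=.
  elim: (q) (u) rq => //= b s IH a /andP[/and3P[_ _ bv] /IH].
  by rewrite inE negb_or eq_sym bv.
case: tree_e => _ _ _ _ /(_ (v :: u :: q)); apply.
  by case: (q) lq uu' => //= <-; rewrite eqxx.
rewrite /ucycle /= rcons_path evu eq -lq e_sym evu' /=.
by move: uq vq => /= -> ->.
Qed.

(** A neighbour [u] not farther from [x] than [v] must be the unique closer neighbour of [v]; hence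
    adjacent vertices are never equidistant from [x]. *)
Lemma dist_neighbor x v u : e v u ->
  d x u = (d x v).+1 \/ d x v = (d x u).+1.
Proof.
move=> evu; have [->|xv] := eqVneq x v; first by left; rewrite distxx dist_edge.
have [w evw dw] := closer_neighbor xv.
have := dist_triangle v x u; rewrite (dist_edge evu) => le_u.
have [le|lt] := leqP (d x u) (d x v); last by left; lia.
by right; rewrite (closer_neighbor_uniq xv evu evw) //; lia.
Qed.

Lemma farther_neighbor x v w u : e v w -> d x v = (d x w).+1 ->
  e v u -> u != w -> d x u = (d x v).+1.
Proof.
move=> evw dw evu uw; have [//|du] := dist_neighbor x evu.
have xv: x != v by rewrite -dist_eq0 dw.
by move: uw; rewrite (closer_neighbor_uniq xv evu evw) ?eqxx //; lia.
Qed.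

(** For [u] adjacent to [v] this is the component of $T-v$ containing [u], described by distances
    alone. *)
Definition branch (v u : T) : {set T} := [set x | d x u < d x v].

Lemma branchE v u x : e v u -> (x \in branch v u) = (d x v == (d x u).+1).
Proof.
by move=> evu; rewrite inE; case: (dist_neighbor x evu) => ->; lia.
Qed.

Lemma branch_root v u : v \notin branch v u.
Proof. by rewrite inE distxx ltn0. Qed.

Lemma branch_neighbor v u : e v u -> u \in branch v u.
Proof. by move=> evu; rewrite inE distxx dist_sym (dist_edge evu). Qed.

Lemma branch_disjoint v u u' x : e v u -> e v u' ->
  x \in branch v u -> x \in branch v u' -> u = u'.
Proof.
move=> evu evu'; rewrite !branchE // => /eqP du /eqP du'.
by apply: (@closer_neighbor_uniq x v) => //; rewrite -?dist_eq0 ?du; lia.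
Qed.

Lemma in_some_branch v x : x != v -> exists2 u, e v u & x \in branch v u.
Proof.
by move=> /closer_neighbor[u evu dx]; exists u; rewrite // inE dx.
Qed.

(** A path leaving the branch passes through [v]. The induction is on the distance from [x] to [u],
    going from [x] to its neighbour [y] closer to [u]. *)
Lemma dist_branch v u x z : e v u -> x \in branch v u -> z \notin branch v u ->
  d x z = d x v + d v z.
Proof.
move=> evu; rewrite branchE // inE -leqNgt => /eqP dxv le_z.
move: {2}(d x u) (leqnn (d x u)) => n.
elim: n x dxv => [|n IH] x dxv le_n.
  have /eqP : d x u == 0 by lia.
  move/eqP; rewrite dist_eq0 => /eqP Ex; rewrite {x}Ex in dxv le_n *.
  have := dist_neighbor z evu; rewrite dxv distxx (dist_sym u) (dist_sym v); lia.
have [xu|xu] := eqVneq x u; first by apply: IH; rewrite // xu distxx.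
rewrite eq_sym in xu; have [y exy dy] := closer_neighbor xu.
have eyx : e y x by rewrite e_sym.
have [dyv le_yn] : d y v = (d y u).+1 /\ d y u <= n.
  move: dy le_n; rewrite (dist_sym u) (dist_sym u y) => dy le_n; split; last lia.
  have := dist_triangle y x v; rewrite (dist_edge exy).
  by case: (dist_neighbor y evu); lia.
have dyz := IH y dyv le_yn.
(* The neighbour [w] of [y] towards [z] is [v] if [y] is [u], and otherwise the neighbour closer to
   [u]. It differs from [x], so [x] is one step farther from [z] than [y]. *)
have [w eyw [dwz wx]] : exists2 w, e y w & d y z = (d w z).+1 /\ w != x.
  have [yu|yu] := eqVneq u y.
    exists v; first by rewrite e_sym -yu.
    split; first by rewrite dyz dyv -yu distxx; lia.
    by apply: contra_eq_neq dxv => <-; rewrite distxx.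
  have [w eyw dw] := closer_neighbor yu; exists w => //.
  have dwv : d w v = (d w u).+1.
    have := dist_triangle w y v; rewrite (dist_edge eyw).
    move: dw; rewrite (dist_sym u) (dist_sym u w) => dw.
    by case: (dist_neighbor w evu); lia.
  have dwu : d y u = (d w u).+1 by rewrite (dist_sym y) (dist_sym w).
  split; first by rewrite (IH w dwv) //; lia.
  by apply: contra_eq_neq dw => ->; lia.
have := @farther_neighbor z y w x eyw; rewrite !(dist_sym z) => -> //.
  by move: dy; rewrite (dist_sym u) (dist_sym u y); lia.
by rewrite eq_sym.
Qed.

(** A branch at [w] pointing away from [v] is nested in the branch at [v] that contains [w]; leaving
    the latter would force a path through both [w] and [v] in contradictory orders. *)
Lemma sub_branch v u w c x : e v u -> e w c ->
  w \in branch v u -> v \notin branch w c -> x \in branch w c ->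
  x \in branch v u /\ d x v = d x w + d w v.
Proof.
move=> evu ewc wB vC xC; have dx := dist_branch ewc xC vC; split=> //.
apply/negPn/negP => xB; have := dist_branch evu wB xB.
have : d w v != 0 by rewrite dist_eq0; apply: contraTneq wB => ->; exact: branch_root.
by rewrite (dist_sym w x) (dist_sym v x); lia.
Qed.

Lemma deg_ge_uniq v s : uniq s -> {in s, forall u, e v u} -> size s <= deg e v.
Proof.
move=> us es; rewrite -(card_uniqP us); apply: subset_leq_card.
by apply/subsetP => u /es; rewrite inE.
Qed.

(** Branches at [w] are disjoint, so at most one neighbour of [w] leads towards [v]. *)
Lemma away_neighbors v w : 2 < deg e w ->
  exists c1 c2, [/\ e w c1, e w c2, c1 != c2, v \notin branch w c1
                  & v \notin branch w c2].
Proof.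
move=> dw; pose S := [set c | e w c & v \notin branch w c].
suff /card_gt1P[c1 [c2 []]] : 1 < #|S|.
  by rewrite !inE => /andP[? ?] /andP[? ?] ?; exists c1, c2; rewrite !inE.
pose S' := [set c | e w c & v \in branch w c].
have : #|S'| <= 1.
  apply/card_le1_eqP => a b; rewrite !inE => /andP[ea va] /andP[eb vb].
  by apply: (branch_disjoint eb ea (x := v)); rewrite inE.
have : deg e w <= #|S| + #|S'|.
  apply: leq_trans (leq_card_setU S S').
  by apply/subset_leq_card/subsetP => c; rewrite !inE => ->; case: ltnP.
lia.
Qed.

Lemma deg_farthest v w :
  (forall c, e w c -> v \notin branch w c -> False) -> deg e w <= 1.
Proof.
move=> far; rewrite leqNgt; apply/negP => /card_gt1P[a [b []]].
rewrite !inE => ea eb; apply/negP/negPn/eqP.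
have inB c : e w c -> v \in branch w c.
  by move=> ec; apply/negPn/negP; exact: far.
exact: branch_disjoint (inB _ ea) (inB _ eb).
Qed.

(** Take a vertex of the branch farthest from [v]: a neighbour leading away from [v] would be
    farther still. *)
Lemma branch_leaf v u : e v u -> exists2 l, l \in branch v u & deg e l = 1.
Proof.
move=> evu; have uB := branch_neighbor evu.
have [l lB far] := @arg_maxnP _ u (mem (branch v u)) (d^~ v) uB.
exists l => //; apply/eqP; rewrite eqn_leq; apply/andP; split.
  apply: (@deg_farthest v) => c elc vC.
  have [cB dc] := sub_branch evu elc lB vC (branch_neighbor elc).
  have := far c cB; rewrite /= dc (dist_sym c) (dist_edge elc); lia.
have vl : v != l by apply: contraTneq lB => <-; exact: branch_root.
have [c elc _] := closer_neighbor vl.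
by apply/card_gt0P; exists c; rewrite inE.
Qed.

(** * Legs and resolving sets *)

(** Starting from an end vertex, the tree cannot fork before it reaches a major vertex: two vertices
    on one level would share a parent of degree at least three, or be two neighbours of [r]. Level
    [n] itself is still a single vertex. *)
Lemma level_uniq r n : deg e r <= 1 -> (forall x, d r x < n -> ~~ major e x) ->
  forall x y, d r x = d r y -> d r x <= n -> x = y.
Proof.
move=> dr nmaj x; move: {2}(d r x) (erefl (d r x)) => k.
elim: k x => [|k IH] x dx y dxy le_n.
  by move/eqP: dx (dx); rewrite {2}dxy dist_eq0 => /eqP<- /eqP; rewrite dist_eq0 => /eqP.
have rx : r != x by rewrite -dist_eq0 dx.
have ry : r != y by rewrite -dist_eq0 -dxy dx.
have [p exp dp] := closer_neighbor rx; have [q eyq dq] := closer_neighbor ry.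
have Epq : p = q by apply: IH; lia.
clear IH.
rewrite -{q}Epq in eyq dq.
apply/eqP; apply/negPn/negP => xy.
have epx : e p x by rewrite e_sym.
have epy : e p y by rewrite e_sym.
have [Ep|rp] := eqVneq r p.
  have := @deg_ge_uniq r [:: x; y]; rewrite /= inE xy => /(_ isT) le2.
  suff : 2 <= deg e r by lia.
  by apply: le2 => u; rewrite Ep !inE => /orP[] /eqP->.
have [t ept dt] := closer_neighbor rp.
have := nmaj p; rewrite /major -leqNgt => /(_ ltac:(lia)).
suff : 3 <= deg e p by lia.
have tx : t != x by apply: contra_eq_neq dt => ->; lia.
have ty : t != y by apply: contra_eq_neq dt => ->; lia.
apply: (@deg_ge_uniq p [:: t; x; y]); first by rewrite /= !inE negb_or tx ty xy.
by move=> u; rewrite !inE => /or3P[] /eqP->.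
Qed.

(** Since the level of [x] is a single vertex, every shortest path from [r] to that level or beyond
    passes through [x]. *)
Lemma level_through r x y :
  deg e r <= 1 -> (forall z, d r z < d r x -> ~~ major e z) ->
  d r x <= d r y -> d r y = d r x + d x y.
Proof.
move=> dr nmaj; move: {2}(d r y) (erefl (d r y)) => k.
elim: k y => [|k IH] y dy le_xy.
  by rewrite (level_uniq dr nmaj (x := x) (y := y)) ?distxx; lia.
have [E|lt_xy] := eqVneq (d r x) (d r y).
  by rewrite (level_uniq dr nmaj E) ?distxx; lia.
have ry : r != y by rewrite -dist_eq0 dy.
have [q eyq dq] := closer_neighbor ry.
have dxq : d r q = d r x + d x q by apply: IH; lia.
have := dist_triangle q x y; have := dist_triangle x r y.
by rewrite (dist_sym q y) (dist_edge eyq); lia.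
Qed.

Lemma exists_deg_le1 : exists r, deg e r <= 1.
Proof.
have /card_gt0P[v _] : 0 < #|T| by case: tree_e.
have [l _ far] := @arg_maxnP _ v predT (d^~ v) isT.
exists l; apply: (@deg_farthest v) => c elc vC.
have cC := branch_neighbor elc; have := far c isT.
rewrite /= (dist_branch elc cC vC) (dist_sym c) (dist_edge elc); lia.
Qed.

(* Without major vertices, the distance to an end vertex is an isomorphism onto
   a path graph. *)
Lemma exists_major : ~ is_path_graph e -> exists v, major e v.
Proof.
move=> npath; apply: contrapT => nmaj; apply: npath.
have nm x : ~~ major e x by apply/negP => mx; apply: nmaj; exists x.
have [r dr] := exists_deg_le1.
have inj x y : d r x = d r y -> x = y.
  by move=> E; apply: (level_uniq dr (n := d r x)) => // z _; exact: nm.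
pose g x : 'I_#|T| := Ordinal (dist_ltn r x).
have g_inj : injective g by move=> x y /(congr1 val) /inj.
have g_bij : bijective g by apply: inj_card_bij; rewrite ?card_ord.
case: (g_bij) => f gK fK; exists #|T|, f; split; first by exists g.
have adj x y : e x y = ((g x).+1 == g y :> nat) || ((g y).+1 == g x :> nat).
  apply/idP/orP => [exy|].
    by have [D|D] := dist_neighbor r exy; [left|right]; rewrite /= D.
  wlog D : x y / (g x).+1 = g y :> nat.
    move=> H [] /eqP D; first by apply: H; [|left; apply/eqP].
    by rewrite e_sym; apply: H; [|left; apply/eqP].
  move=> _; rewrite /= in D.
  have ry : r != y by rewrite -dist_eq0 -D.
  have [q eyq dq] := closer_neighbor ry.
  by rewrite e_sym (inj x q) //; lia.
by move=> i j; rewrite adj !fK.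
Qed.

(** * Terminal vertices and their legs *)

Lemma terminal_inj l v w : terminal e l v -> terminal e l w -> v = w.
Proof.
case/and3P=> _ mv /forallP/(_ w) lv; case/and3P=> _ mw /forallP/(_ v) lw.
apply/eqP; apply/negPn/negP => vw; move: lv lw.
by rewrite mv mw vw eq_sym vw /=; lia.
Qed.

(** Take a major vertex nearest to [l]; another one at the same distance is excluded by
    [level_uniq]. *)
Lemma exists_terminal l : (exists v, major e v) -> deg e l = 1 ->
  exists v, terminal e l v.
Proof.
move=> [w mw] dl; have [v mv near] := @arg_minnP _ w (major e) (d l) mw.
have nmaj x : d l x < d l v -> ~~ major e x.
  by apply: contraL => /near; rewrite -leqNgt.
exists v; apply/and3P; split=> //; first by rewrite dl.
apply/forallP => z; apply/implyP => /andP[mz zv].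
have := near z mz; have dl1 : deg e l <= 1 by rewrite dl.
have := level_uniq dl1 nmaj (x := v) (y := z) => E.
rewrite leq_eqVlt => /orP[/eqP /E Ez|//].
by move: zv; rewrite Ez ?eqxx.
Qed.

(* For l terminal at v this is the path from l to v without v. *)
Definition leg l v : {set T} := [set x | d l x < d l v].

Section Terminal.
Variables l v : T.
Hypothesis ter_lv : terminal e l v.

Let deg_l : deg e l = 1. Proof. by case/and3P: ter_lv => /eqP. Qed.
Let deg_l1 : deg e l <= 1. Proof. by rewrite deg_l. Qed.

Lemma leg_not_major x : x \in leg l v -> ~~ major e x.
Proof.
rewrite inE => dx; apply/negP => mx.
case/and3P: ter_lv => _ _ /forallP/(_ x); rewrite mx /=.
by have [Ex|_ /=] := eqVneq x v; [move: dx; rewrite Ex ltnn | lia].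
Qed.

Lemma terminal_neq : l != v.
Proof.
case/and3P: ter_lv => _ + _; rewrite /major.
by apply: contraTneq => <-; rewrite deg_l.
Qed.

Lemma leaf_in_leg : l \in leg l v.
Proof. by rewrite inE distxx lt0n dist_eq0 terminal_neq. Qed.

Lemma dist_in_leg x : x \in leg l v -> d l v = d l x + d x v.
Proof.
rewrite inE => lt_x; apply: level_through => //; last exact: ltnW.
by move=> z lt_z; apply: leg_not_major; rewrite inE; lia.
Qed.

Lemma dist_out_leg x y : x \in leg l v -> y \notin leg l v ->
  d x y = d x v + d v y.
Proof.
move=> xl yl; have := dist_in_leg xl; have := dist_triangle x l y.
have := dist_triangle v x y.
have : d l y = d l v + d v y.
  apply: level_through => //; last by move: yl; rewrite inE -leqNgt.
  by move=> z; move: (@leg_not_major z); rewrite inE; apply.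
lia.
Qed.

(** Any other vertex of the leg has one neighbour towards [v] and another towards [l]. *)
Lemma leg_leaf x : x \in leg l v -> deg e x = 1 -> x = l.
Proof.
move=> xl dx; apply/eqP; apply/negPn/negP => xl'; have dl := dist_in_leg xl.
have vx : v != x by apply: contraTneq xl => <-; rewrite inE ltnn.
have [a exa da] := closer_neighbor vx.
have lx : l != x by rewrite eq_sym.
have [b exb db] := closer_neighbor lx.
have := @deg_ge_uniq x [:: a; b]; rewrite dx /= inE.
have -> : a != b.
  apply: contra_eq_neq da => ->; have := dist_triangle b l v.
  by rewrite (dist_sym v) (dist_sym v); lia.
move/(_ isT)=> H; suff : 2 <= 1 by [].
by apply: H => u; rewrite !inE => /orP[] /eqP->.
Qed.

Lemma leg_card2 : ~~ e v l -> 1 < #|leg l v|.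
Proof.
move=> nvl; have vl : v != l by rewrite eq_sym terminal_neq.
have [a ela da] := closer_neighbor vl.
apply/card_gt1P; exists l, a; split; first exact: leaf_in_leg.
  rewrite inE (dist_edge ela) dist_sym ltn_neqAle eq_sym lt0n dist_eq0 vl andbT.
  by apply: contra nvl => /eqP/dist1_edge.
by apply: contraTneq ela => <-; rewrite e_irr.
Qed.

Lemma leg_adjacent : e v l -> leg l v = [set l].
Proof.
move=> evl; apply/setP => x; rewrite !inE (dist_sym l v) (dist_edge evl).
by rewrite ltnS leqn0 dist_eq0 eq_sym.
Qed.

Lemma leg_top_neighbor : exists2 u, u \in leg l v & e v u.
Proof.
have [u evu du] := closer_neighbor terminal_neq.
by exists u; rewrite // inE du.
Qed.

End Terminal.

Lemma leg_disjoint l1 v1 l2 v2 : terminal e l1 v1 -> terminal e l2 v2 ->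
  l1 != l2 -> [disjoint leg l1 v1 & leg l2 v2].
Proof.
move=> t1 t2 l12; apply/pred0P => x /=; apply/negbTE/negP => /andP[x1 x2].
(* With a common top, the route through [x] would be shorter than the route between the leaves
   through [v1]. With distinct tops, leaving each leg through its own top gives twice the distance
   between the tops as zero. *)
have [Ev|v12] := eqVneq v1 v2.
  rewrite -{v2}Ev in t2 x2.
  have l2_1 : l2 \notin leg l1 v1.
    apply: contraNN l12 => l2_1; rewrite -(leg_leaf t1 l2_1) //.
    by case/and3P: t2 => /eqP.
  have := dist_out_leg t1 (leaf_in_leg t1) l2_1; have := dist_triangle x l1 l2.
  move: x1 x2; rewrite !inE (dist_sym v1 l2) (dist_sym x l2); lia.
have v2_1 : v2 \notin leg l1 v1.
  by apply/negP => /(leg_not_major t1); case/and3P: t2 => _ ->.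
have v1_2 : v1 \notin leg l2 v2.
  by apply/negP => /(leg_not_major t2); case/and3P: t1 => _ ->.
have := dist_out_leg t1 x1 v2_1; have := dist_out_leg t2 x2 v1_2.
by move: v12; rewrite -dist_eq0 (dist_sym v2 v1); lia.
Qed.

(* The neighbours of v on the two legs have the same distance to every vertex
   outside both legs. *)
Lemma resolving_meets_legs W l1 l2 v : resolving e W ->
  terminal e l1 v -> terminal e l2 v -> l1 != l2 ->
  exists2 z, z \in W & z \in leg l1 v :|: leg l2 v.
Proof.
move=> resW t1 t2 l12.
have [u1 u1l e1] := leg_top_neighbor t1; have [u2 u2l e2] := leg_top_neighbor t2.
have u12 : u1 != u2.
  apply: contraTneq u1l => ->.
  by have /pred0P/(_ u2) /= := leg_disjoint t1 t2 l12; rewrite u2l andbT => ->.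
move/forallP/(_ u1)/forallP/(_ u2): resW; rewrite u12 /= => /exists_inP[z zW dz].
exists z => //; apply: contraR dz; rewrite in_setU negb_or => /andP[z1 z2].
rewrite (dist_out_leg t1 u1l z1) (dist_out_leg t2 u2l z2).
by rewrite !(dist_sym _ v) (dist_edge e1) (dist_edge e2) eqxx.
Qed.

(** Every vertex outside the branch is reached from its leaf through [v], so [v] is strictly nearest
    among the major vertices. *)
Lemma branch_leg v u : e v u -> major e v ->
  (forall w, w \in branch v u -> ~~ major e w) ->
  exists l, [/\ terminal e l v, l \in branch v u & leg l v \subset branch v u].
Proof.
move=> evu mv nmaj; have [l lB dl] := branch_leaf evu; exists l; split=> //.
  apply/and3P; split=> //; first by rewrite dl.
  apply/forallP => w; apply/implyP => /andP[mw wv].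
  have wB : w \notin branch v u by apply: contraL mw => /nmaj.
  rewrite (dist_branch evu lB wB).
  by move: wv; rewrite eq_sym -dist_eq0; lia.
apply/subsetP => x; rewrite [x \in leg _ _]inE; apply: contraTT => xB.
by rewrite (dist_branch evu lB xB) -leqNgt leq_addr.
Qed.

(* Take a major vertex of the branch farthest from v. *)
Lemma branch_two_legs v u w : e v u -> w \in branch v u -> major e w ->
  exists m l1 l2, [/\ terminal e l1 m, terminal e l2 m, l1 != l2,
    leg l1 m \subset branch v u & leg l2 m \subset branch v u].
Proof.
move=> evu wB mw; have wP : (w \in branch v u) && major e w by rewrite wB.
have [m /andP[mB mm] far] :=
  @arg_maxnP _ w [pred x | (x \in branch v u) && major e x] (d^~ v) wP.
have [c1 [c2 [e1 e2 c12 v1 v2]]] := away_neighbors v mm.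
have nmaj c : e m c -> v \notin branch m c ->
    forall x, x \in branch m c -> ~~ major e x.
  move=> emc vC x xC; apply/negP => mx.
  have [xB dx] := sub_branch evu emc mB vC xC.
  have := far x; rewrite /= xB mx dx => /(_ isT).
  rewrite -[X in _ <= X]add0n leq_add2r leqn0 dist_eq0 => /eqP Ex.
  by rewrite Ex (negbTE (branch_root m c)) in xC.
have [l1 [t1 l1B s1]] := branch_leg e1 mm (nmaj _ e1 v1).
have [l2 [t2 l2B s2]] := branch_leg e2 mm (nmaj _ e2 v2).
exists m, l1, l2; split=> //.
- apply: contraTneq c12 => El; rewrite negbK; apply/eqP.
  by apply: branch_disjoint l1B _ => //; rewrite El.
- by apply/subsetP => x /(subsetP s1) /(sub_branch evu e1 mB v1)[].
- by apply/subsetP => x /(subsetP s2) /(sub_branch evu e2 mB v2)[].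
Qed.

(** The vertex [m] is where paths from [x] and [y] to [z] meet; it is found by moving both ends one
    step towards [z] until they coincide. The vertices just before [m] are [a] and [b]. *)
Lemma equidistant_branches x y z : x != y -> d x z = d y z ->
  exists m a b, [/\ e m a, e m b, a != b,
    x \in branch m a /\ y \in branch m b & d x m = d y m].
Proof.
move=> xy dxy.
suff [m [a [b [ema emb ab [da db] [dx dy]]]]] : exists m a b, [/\ e m a, e m b,
    a != b, d a z = (d m z).+1 /\ d b z = (d m z).+1
    & d x z = d x a + d a z /\ d y z = d y b + d b z].
  exists m, a, b; split=> //; rewrite ?inE.
    have := dist_triangle m x z; have := dist_triangle m y z; lia.
  have := dist_triangle m x z; have := dist_triangle m y z.
  have := dist_triangle a x m; have := dist_triangle b y m.
  by rewrite !(dist_sym _ m) (dist_edge ema) (dist_edge emb); lia.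
move: {2}(d x z) (erefl (d x z)) => n; elim: n x y xy dxy => [|n IH] x y xy dxy dn.
  move/eqP: xy; case; move/eqP: (dn); rewrite dist_eq0 => /eqP->.
  by apply/esym/eqP; rewrite -dist_eq0 -dxy dn.
have zx : z != x by rewrite -dist_eq0 dist_sym dn.
have zy : z != y by rewrite -dist_eq0 dist_sym -dxy dn.
have [a exa] := closer_neighbor zx; have [b eyb] := closer_neighbor zy.
rewrite !(dist_sym z) => db da.
have [ab|ab] := eqVneq a b.
  exists a, x, y; rewrite e_sym exa {1}ab e_sym eyb !distxx; split=> //.
  by rewrite {2}ab.
have [m [a' [b' [ema emb ab' [da' db'] [dx dy]]]]] := IH a b ab ltac:(lia) ltac:(lia).
exists m, a', b'; split=> //.
have := dist_triangle a x a'; have := dist_triangle b y b'.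
have := dist_triangle a' x z; have := dist_triangle b' y z.
by rewrite (dist_edge exa) (dist_edge eyb); lia.
Qed.

Lemma meets_legs_resolving (W : {set T}) : (exists v, major e v) ->
  (forall v l1 l2, terminal e l1 v -> terminal e l2 v -> l1 != l2 ->
     exists2 z, z \in W & z \in leg l1 v :|: leg l2 v) ->
  resolving e W.
Proof.
move=> [w mw] hitW.
have no_major m a : e m a -> [disjoint W & branch m a] ->
    forall x, x \in branch m a -> ~~ major e x.
  move=> ema dW x xB; apply/negP => mx.
  have [v [l1 [l2 [t1 t2 l12 s1 s2]]]] := branch_two_legs ema xB mx.
  have [z zW] := hitW _ _ _ t1 t2 l12; move/pred0P/(_ z): dW => /=.
  by rewrite zW in_setU /= => zB /orP[/(subsetP s1)|/(subsetP s2)]; rewrite zB.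
have not_both m a b : e m a -> e m b -> a != b -> major e m ->
    [disjoint W & branch m a] -> [disjoint W & branch m b] -> False.
  move=> ema emb ab mm da db.
  have [l1 [t1 l1B s1]] := branch_leg ema mm (no_major _ _ ema da).
  have [l2 [t2 l2B s2]] := branch_leg emb mm (no_major _ _ emb db).
  have l12 : l1 != l2.
    apply: contraTneq ab => El; rewrite negbK; apply/eqP.
    by apply: branch_disjoint l1B _ => //; rewrite El.
  have [z zW] := hitW _ _ _ t1 t2 l12; move/pred0P/(_ z): da => /=.
  move/pred0P/(_ z): db => /=; rewrite zW in_setU /= => zb za.
  by case/orP=> [/(subsetP s1)|/(subsetP s2)]; rewrite ?za ?zb.
(* A vertex of [W] is needed to locate the midpoint. If [W] were empty, two branches at the major
   vertex [w] would both be missed. *)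
have [z0 z0W] : exists z, z \in W.
  apply/set0Pn/eqP => W0; have : 1 < deg e w by apply: leq_trans mw.
  case/card_gt1P=> a [b []]; rewrite !inE => ewa ewb ab.
  by apply: (not_both w a b) => //; rewrite W0; apply/pred0P => c /=; rewrite in_set0.
apply/forallP => x; apply/forallP => y; apply/implyP => xy.
apply/exists_inP; apply: contrapT => same.
have eqd z : z \in W -> d x z = d y z.
  by move=> zW; apply/eqP/negPn/negP => dz; apply: same; exists z.
have [m [a [b [ema emb ab [xa yb] dm]]]] := equidistant_branches xy (eqd _ z0W).
(* From a vertex [z] of the branch at [c], [x'] is reached without passing [m] and [y'] only through
   [m]; as both are equally far from [m], such a [z] in [W] would distinguish them. *)
have miss c x' y' : e m c -> x' \in branch m c -> y' \notin branch m c ->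
    d x' m = d y' m -> {in W, forall z, d x' z = d y' z} -> [disjoint W & branch m c].
  move=> emc xc yc dxy Wd; apply/pred0P => z /=; apply/negP => /andP[zW zc].
  have := dist_branch emc zc yc; rewrite (dist_sym z y') -Wd //.
  have := dist_triangle c x' z; rewrite (dist_sym c z).
  move: xc zc; rewrite !inE (dist_sym m y') -dxy; lia.
have ba c c' : e m c -> e m c' -> c != c' -> forall t, t \in branch m c -> t \notin branch m c'.
  by move=> ec ec' cc' t tc; apply: contra cc' => /(branch_disjoint ec ec' tc) ->.
have da : [disjoint W & branch m a].
  by apply: (miss a x y) => //; apply: (ba b a) => //; rewrite eq_sym.
have db : [disjoint W & branch m b].
  apply: (miss b y x) => //; first by apply: (ba a b).
  by move=> z /eqd.
have [mm|nmm] := boolP (major e m); first exact: not_both da db.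
(* Now [m] is not major, yet [w] lies in a branch other than the two missed ones, which gives [m] a
   third neighbour. *)
have wm : w != m by apply: contraTneq mw => ->.
have [c emc wc] := in_some_branch wm.
have [ca|ca] := eqVneq c a.
  by move: (no_major _ _ ema da w); rewrite -ca wc mw => /(_ isT).
have [cb|cb] := eqVneq c b.
  by move: (no_major _ _ emb db w); rewrite -cb wc mw => /(_ isT).
case/negP: nmm; apply: (@deg_ge_uniq m [:: c; a; b]).
  by rewrite /= !inE negb_or ca cb ab.
by move=> u; rewrite !inE => /or3P[] /eqP->.
Qed.

End TreeMetric.

(** * Strategies *)

Lemma least_eq (P : nat -> Prop) n :
  P n -> (forall m, m < n -> ~ P m) -> least P = Some n.
Proof.
move=> Pn minP; rewrite /least; case: pselect => [h|[]]; last first.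
  by exists n; apply/asboolP.
case: ex_minnP => m /asboolP Pm le_m; congr Some; apply/eqP.
rewrite eqn_leq le_m ?asboolT //= leqNgt; apply/negP => /minP; exact.
Qed.

Lemma card_setD1_ge (T : finType) (A : {set T}) x : #|A| <= #|A :\ x|.+1.
Proof. by rewrite (cardsD1 x A) -add1n leq_add2r leq_b1. Qed.

Section Games.
Variables (T : finType) (e : rel T) (first : player).
Implicit Types (h p : seq T) (s : strategy T) (pl : player) (x y z : T).

Local Notation turn := (turn first).
Local Notation chosen := (@chosen T first).

(** * Histories, strategies and plays *)

Lemma chosen_rcons pl h x : uniq (rcons h x) ->
  chosen pl (rcons h x) =
    if turn (size h) == pl then x |: chosen pl h else chosen pl h.
Proof.
rewrite rcons_uniq => /andP[xh uh]; apply/setP => y.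
rewrite /Defs.chosen; case: ifP => tx; rewrite !inE mem_rcons inE -cats1 index_cat.
  have [->|yx] := eqVneq y x; first by rewrite (negbTE xh) /= eqxx addn0 tx.
  by case: (y \in h).
have [->|yx] := eqVneq y x; first by rewrite (negbTE xh) /= eqxx addn0 tx.
by case: (y \in h).
Qed.

Lemma chosen_nil pl : chosen pl [::] = set0.
Proof. by apply/setP => x; rewrite !inE. Qed.

Lemma chosen_mem pl h x : x \in chosen pl h -> x \in h.
Proof. by rewrite inE => /andP[]. Qed.

Lemma chosen_prefix pl h p : prefix h p -> chosen pl h \subset chosen pl p.
Proof.
case/prefixP=> t ->; apply/subsetP => x; rewrite !inE mem_cat index_cat.
by case/andP=> -> ->.
Qed.

Lemma chosen_disjoint h x :
  x \in chosen Resolver h -> x \in chosen Spoiler h -> False.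
Proof. by rewrite !inE => /andP[_ /eqP->] /andP[_]. Qed.

Lemma prefix_rconsl h x p : prefix (rcons h x) p -> prefix h p.
Proof. by apply: prefix_trans; exact: prefix_rcons. Qed.

Lemma prefix_ind p (P : seq T -> Prop) : P [::] ->
  (forall h x, prefix (rcons h x) p -> P h -> P (rcons h x)) ->
  forall h, prefix h p -> P h.
Proof.
move=> P0 PS; elim/last_ind => // h x IH hx.
by apply: PS => //; apply: IH; exact: prefix_rconsl hx.
Qed.

(** Turns a preference for certain moves into a total legal strategy: without a preferred free
    vertex it takes any free one, and [x0] is returned only when no vertex is free. *)
Lemma legal_preference (Q : seq T -> pred T) : 0 < #|T| ->
  exists2 s, legal_strategy s &
    forall h, (exists2 x, x \notin h & Q h x) -> Q h (s h).
Proof.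
case/card_gt0P=> x0 _.
pose s h := if [pick x | (x \notin h) && Q h x] is Some x then x
            else odflt x0 [pick x | x \notin h].
exists s => [h uh sh|h [x xh Qx]]; rewrite /s; last first.
  by case: pickP => [y /andP[]//|/(_ x)]; rewrite xh Qx.
case: pickP => [y /andP[]//|_]; case: pickP => //= all_h.
move: sh; rewrite -(card_uniqP uh) ltnNge; case/negP.
by apply/subset_leq_card/subsetP => x _; move: (all_h x) => /negbFE.
Qed.

(** The history after [n] moves when [s] moves for both players. *)
Fixpoint play (s : strategy T) n : seq T :=
  if n is n'.+1 then rcons (play s n') (s (play s n')) else [::].

Lemma size_play s n : size (play s n) = n.
Proof. by elim: n => //= n IH; rewrite size_rcons IH. Qed.

Lemma play_follows s n h x : prefix (rcons h x) (play s n) -> x = s h.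
Proof.
elim: n => [|n IH]; first by case: h.
case/prefixP=> t; case/lastP: t => [|t y].
  by rewrite cats0 => /rcons_inj[<- <-].
by rewrite -rcons_cat => /rcons_inj[E _]; apply: IH; apply/prefixP; exists t.
Qed.

Lemma play_uniq s n : legal_strategy s -> n <= #|T| -> uniq (play s n).
Proof.
move=> ls; elim: n => //= n IH lt_n; have uh := IH (ltnW lt_n).
by rewrite rcons_uniq uh andbT; apply: ls; rewrite ?size_play.
Qed.

Lemma exists_play s1 s2 : legal_strategy s1 -> legal_strategy s2 ->
  exists p, [/\ complete_play p, follows first Resolver s1 p
              & follows first Spoiler s2 p].
Proof.
move=> l1 l2; pose s h := if turn (size h) == Resolver then s1 h else s2 h.
have ls : legal_strategy s.
  by move=> h uh sh; rewrite /s; case: ifP => _; [exact: l1 | exact: l2].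
exists (play s #|T|); split.
- by split; [exact: play_uniq | exact: size_play].
- by move=> h x /play_follows -> th; rewrite /s th eqxx.
- by move=> h x /play_follows -> th; rewrite /s th.
Qed.

(** For Spoiler: selected sets only grow and the players' sets are disjoint, so once Spoiler meets
    every resolving set, Resolver's set is not resolving at any time. *)
Lemma wins_within_winning pl k :
  wins_within e first pl k -> has_winning_strategy e first pl.
Proof.
case=> s ls ws; exists s => // p cp fp; have [h [hp _ wh]] := ws p cp fp.
case: pl wh {ws fp} => /= wh; first by exists h.
case=> h' h'p /wh /pred0Pn[x /= /andP[xR xS]].
apply: (@chosen_disjoint p x).
  exact: (subsetP (chosen_prefix _ h'p)).
exact: (subsetP (chosen_prefix _ hp)).
Qed.

Lemma winning_exclusive : has_winning_strategy e first Resolver ->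
  has_winning_strategy e first Spoiler -> False.
Proof.
move=> [s1 l1 w1] [s2 l2 w2]; have [p [cp f1 f2]] := exists_play l1 l2.
exact: (w2 p cp f2) (w1 p cp f1).
Qed.

(** Lower bounds on the number of moves use one actual history, obtained by letting the strategy
    play against itself. *)
Lemma wins_within_exists pl k : wins_within e first pl k ->
  exists h, #|chosen pl h| <= k /\ has_won e first pl h.
Proof.
case=> s ls ws; have [p [cp f1 f2]] := exists_play ls ls.
have [|h [_ ? ?]] := ws p cp; last by exists h.
by case: pl {ws} => //.
Qed.

(* Resolver always moves in a block he has not met yet, taking one with the
   fewest free vertices.  When Spoiler is to move every unmet block has two free
   vertices, so when Resolver is to move at most one has fewer. *)
Lemma blocks_wins_within (I : {set T}) (F : T -> {set T}) :
    0 < #|T| ->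
    {in I &, forall i j, i != j -> [disjoint F i & F j]} ->
    (forall W : {set T}, {in I, forall i, exists2 x, x \in W & x \in F i} ->
       resolving e W) ->
    {in I, forall i, 0 < #|F i|} ->
    {in I &, forall i j, #|F i| <= 1 -> #|F j| <= 1 -> i = j} ->
    (first = Spoiler -> {in I, forall i, 1 < #|F i|}) ->
  wins_within e first Resolver #|I|.
Proof.
move=> T0 disF resF F0 F1 F2.
pose unmet h := [set i in I | [disjoint F i & chosen Resolver h]].
pose free h i := F i :\: [set x in h].
pose Q h := [pred x | [exists i in unmet h, (x \in F i) &&
  [forall j in unmet h, #|free h i| <= #|free h j|]]].
have [s ls sQ] := legal_preference Q T0.
exists s => // p [up sp] fp.
have sT x : x \in p.
  have /subset_cardP pT : #|p| = #|T| by rewrite (card_uniqP up).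
  by move: (subset_predT (mem p)) => /pT ->.
have met_wins h : unmet h = set0 -> resolving e (chosen Resolver h).
  move=> u0; apply: resF => i iI; have /negbT : i \in unmet h = false by rewrite u0 inE.
  by rewrite inE iI => /pred0Pn[x /= /andP[? ?]]; exists x.
pose Inv h := [/\ #|chosen Resolver h| + #|unmet h| <= #|I|,
  {in unmet h, forall i, 0 < #|free h i|},
  {in unmet h &, forall i j, #|free h i| <= 1 -> #|free h j| <= 1 -> i = j} &
  turn (size h) = Spoiler -> {in unmet h, forall i, 1 < #|free h i|}].
(* Resolver keeps moving after all blocks are met, which would break the count in [Inv]; the first
   alternative therefore records an earlier prefix at which he had already won. *)
have won_or_inv h : prefix h p ->
    (exists h', [/\ prefix h' p, #|chosen Resolver h'| <= #|I| & unmet h' = set0])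
    \/ Inv h.
  move: h; apply: prefix_ind.
    right; rewrite /Inv; have free0 i : free [::] i = F i.
      by apply/setP => x; rewrite !inE.
    have unmetI i : i \in unmet [::] -> i \in I by rewrite inE => /andP[].
    split; first 1 last.
    - by move=> i /unmetI ?; rewrite free0 F0.
    - by move=> i j /unmetI ? /unmetI ?; rewrite !free0; exact: F1.
    - by move=> fS i /unmetI ?; rewrite free0 F2.
    by rewrite chosen_nil cards0 add0n; apply/subset_leq_card/subsetP.
  move=> h x hxp [|[I1 I2 I3 I4]]; first by left.
  have uhx : uniq (rcons h x) by have /prefixP[t E] := hxp; move: up; rewrite E cat_uniq => /andP[].
  have hp := prefix_rconsl hxp.
  have xh : x \notin h by move: uhx; rewrite rcons_uniq => /andP[].
  have chR := chosen_rcons Resolver uhx.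
  have freeE i : free (rcons h x) i = free h i :\ x.
    by apply/setP => y; rewrite !inE mem_rcons inE negb_or andbA.
  have [u0|/set0Pn[i0 i0u]] := eqVneq (unmet h) set0.
    by left; exists h; split=> //; move: I1; rewrite u0 cards0 addn0.
  have unmetI h' i : i \in unmet h' -> i \in I by rewrite inE => /andP[].
  right; case tx: (turn (size h) == Resolver); rewrite tx in chR.
    have xs := fp h x hxp (eqP tx).
    have : Q h x.
      rewrite xs; apply: sQ.
      have [i iu min_i] := @arg_minnP _ i0 (mem (unmet h)) (fun i => #|free h i|) i0u.
      have /card_gt0P[y] := I2 i iu; rewrite !inE => /andP[yh yF].
      exists y => //; apply/exists_inP; exists i => //; rewrite yF.
      by apply/forall_inP => j /min_i.
    case/exists_inP=> i iu /andP[xF /forall_inP min_i].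
    have unmet' j : j \in unmet (rcons h x) -> (j \in unmet h) && (j != i).
      rewrite !inE chR => /andP[jI /pred0P dj]; rewrite jI /=; apply/andP; split.
        by apply/pred0P => y; move: (dj y); rewrite /= in_setU1; case: (y \in F j) => //= /norP[_ /negbTE].
      apply: contraTneq xF => <-; have := dj x; rewrite /= in_setU1 eqxx andbT.
      by move=> ->.
    have free' j : j \in unmet (rcons h x) -> free (rcons h x) j = free h j.
      move=> /unmet' /andP[ju]; rewrite eq_sym freeE => ij; apply/setDidPl.
      rewrite disjoint_sym disjoints1 !inE negb_and orbC.
      have /pred0P/(_ x) /= := disF i j (unmetI _ _ iu) (unmetI _ _ ju) ij.
      by rewrite xF /= => ->.
    (* An unmet block with at most one free vertex would, by the minimal choice of [i], force the
       same for [i], and two such blocks coincide. *)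
    have big j : j \in unmet (rcons h x) -> 1 < #|free (rcons h x) j|.
      move=> ju'; rewrite free' //; have /andP[ju ji] := unmet' j ju'.
      rewrite ltnNge; apply/negP => le1; move/eqP: ji; apply.
      by apply: I3 => //; apply: leq_trans le1; exact: min_i.
    split.
    - rewrite chR cardsU1 (_ : x \notin _ = true) ?add1n; last first.
        by apply/negP => /chosen_mem; rewrite (negbTE xh).
      apply: leq_trans I1; rewrite addSnnS leq_add2l; apply: proper_card.
      apply/properP; split; first by apply/subsetP => j /unmet' /andP[].
      by exists i => //; apply/negP => /unmet'; rewrite eqxx andbF.
    - by move=> j /big; apply: ltnW.
    - by move=> j k /big; rewrite ltnNge => /negbTE->.
    - by move=> _ j /big.
  have tS : turn (size h) = Spoiler by case: (turn _) tx.
  have unmetE : unmet (rcons h x) = unmet h by rewrite /unmet chR.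
  split; rewrite ?unmetE ?chR //.
  - move=> i iu; rewrite freeE -ltnS.
    exact: leq_trans (I4 tS i iu) (card_setD1_ge _ x).
  - have inF i : i \in unmet h -> #|free (rcons h x) i| <= 1 -> x \in F i.
      move=> iu; rewrite freeE; have := I4 tS i iu; rewrite (cardsD1 x (free h i)).
      by case xi: (x \in free h i); [move: xi; rewrite inE => /andP[] | case: ltnP].
    move=> i j iu ju /(inF i iu) xi /(inF j ju) xj; apply/eqP; apply/negPn/negP => ij.
    by have /pred0P/(_ x) /= := disF i j (unmetI _ _ iu) (unmetI _ _ ju) ij; rewrite xi xj.
  - by move: tS; rewrite size_rcons /Defs.turn /=; case: (odd _) => /=; case: first.
have [[h [hp ch u0]]|[I1 I2 _ _]] := won_or_inv p (prefix_refl p).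
  by exists h; split=> //; exact: met_wins.
(* At the end of the play no vertex is free, whereas the invariant gives every unmet block a free
   vertex. *)
have u0 : unmet p = set0.
  apply/setP => i; rewrite in_set0; apply/negP => /I2 /card_gt0P[x].
  by rewrite !inE sT.
exists p; split=> //=; [exact: prefix_refl | | exact: met_wins].
by move: I1; rewrite u0 cards0 addn0.
Qed.

(* Spoiler takes two vertices of one class A v; his first move is in a class
   with three free vertices, so Resolver cannot answer both threats. *)
Lemma classes_wins_within (A : T -> {set T}) :
    0 < #|T| -> (forall v x y W, x \in A v -> y \in A v -> x != y ->
       resolving e W -> (x \in W) || (y \in W)) ->
    (first = Spoiler -> exists v, 2 < #|A v|) ->
    (first = Resolver -> forall x, exists v, 2 < #|A v :\ x|) ->
  wins_within e first Spoiler 2.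
Proof.
move=> T0 twinA AS AR.
pose Q h := if chosen Spoiler h == set0
  then [pred x | [exists v, (x \in A v) && (2 < #|A v :\: [set y in h]|)]]
  else [pred x | [exists v, exists y in chosen Spoiler h, (y \in A v) && (x \in A v)]].
have [s ls sQ] := legal_preference Q T0.
exists s => // p [up sp] fp.
(* Here [h0] is the history before Spoiler's first move: empty, or Resolver's opening move alone.
   Then Spoiler, Resolver and Spoiler move. *)
have win h0 x1 x2 x3 : prefix (rcons (rcons (rcons h0 x1) x2) x3) p ->
    turn (size h0) = Spoiler -> chosen Spoiler h0 = set0 ->
    (exists v, 2 < #|A v :\: [set y in h0]|) ->
    exists h, [/\ prefix h p, #|chosen Spoiler h| <= 2 & has_won e first Spoiler h].
  move=> p3 t0 c0 [v0 v0A]; set h1 := rcons h0 x1; set h2 := rcons h1 x2.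
  set h3 := rcons h2 x3; rewrite -/h1 -/h2 -/h3 in p3.
  have u3 : uniq h3 by have /prefixP[t E] := p3; move: up; rewrite E cat_uniq => /andP[].
  have u2 : uniq h2 by move: u3; rewrite rcons_uniq => /andP[].
  have u1 : uniq h1 by move: u2; rewrite rcons_uniq => /andP[].
  have p2 := prefix_rconsl p3; have p1 := prefix_rconsl p2.
  have t1 : turn (size h1) == Spoiler = false.
    by move: t0; rewrite size_rcons /Defs.turn /=; case: (odd _) => /=; case: first.
  have t2 : turn (size h2) = Spoiler.
    by move: t0; rewrite !size_rcons /Defs.turn /= negbK.
  have c1 : chosen Spoiler h1 = [set x1] by rewrite chosen_rcons // t0 eqxx c0 setU0.
  have c2 : chosen Spoiler h2 = [set x1] by rewrite chosen_rcons // t1.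
  have c3 : chosen Spoiler h3 = [set x3; x1] by rewrite chosen_rcons // t2 eqxx c2.
  have /existsP[v /andP[x1A cA]] : [exists v, (x1 \in A v) && (2 < #|A v :\: [set y in h0]|)].
    have := sQ h0; rewrite -(fp h0 x1 p1 t0) /Q c0 eqxx; apply.
    have /card_gt0P[y] : 0 < #|A v0 :\: [set y in h0]| by exact: leq_trans v0A.
    rewrite !inE => /andP[yh yA]; exists y => //=.
    by apply/existsP; exists v0; rewrite yA.
  have x10 : [set x1] != set0 by apply/set0Pn; exists x1; rewrite inE.
  have /existsP[v' /exists_inP[y]] :
      [exists v, exists y in chosen Spoiler h2, (y \in A v) && (x3 \in A v)].
    have := sQ h2; rewrite -(fp h2 x3 p3 t2) /Q c2 (negbTE x10); apply.
    (* Of the three free vertices, [x1] and [x2] remove at most two. *)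
    have /card_gt0P[y] : 0 < #|(A v :\: [set y in h0]) :\ x1 :\ x2|.
      rewrite -2!ltnS; apply: leq_trans cA _.
      by apply: leq_trans (card_setD1_ge _ x1) _; rewrite ltnS card_setD1_ge.
    rewrite !inE => /and4P[yx2 yx1 yh yA]; exists y.
      by rewrite /h2 /h1 !(mem_rcons, inE) !negb_or yx2 yx1.
    by apply/existsP; exists v; apply/exists_inP; exists x1; rewrite ?inE ?x1A.
  rewrite c2 inE => /eqP-> /andP[x1A' x3A'].
  have x13 : x1 != x3.
    move: u3; rewrite /h3 /h2 /h1 rcons_uniq !(mem_rcons, inE) !negb_or.
    by case/andP=> /and3P[_ x31 _] _; rewrite eq_sym.
  exists h3; split=> //; first by rewrite c3 cards2; case: (_ != _).
  move=> W resW; apply/pred0Pn; have := twinA v' x1 x3 W x1A' x3A' x13 resW.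
  by case/orP=> xW; [exists x1 | exists x3]; rewrite /= xW c3 !inE eqxx ?orbT.
have first_turn : turn 0 = first by [].
have pfx h t : p = h ++ t -> prefix h p by move=> ->; exact: prefix_prefix.
have [Ef|Ef] : first = Resolver \/ first = Spoiler by case: first; [left|right].
  case: p up sp fp win pfx => [|x0 q] up sp fp win pfx.
    by move: T0; rewrite -sp.
  have [v vA] := AR Ef x0.
  (* Together with [x0], three further vertices of [A v] ensure that the play is long enough for
     [win]. *)
  have : 3 < size (x0 :: q).
    rewrite sp; apply: leq_trans (max_card (mem (x0 |: A v))).
    by rewrite cardsU1; move: vA; rewrite (cardsD1 x0 (A v)); case: (_ \in _) => /=; lia.
  case: q up sp fp win pfx => [|x1 [|x2 [|x3 q]]] // up sp fp win pfx _.
  apply: (win [:: x0] x1 x2 x3).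
  - exact: (pfx _ q).
  - by rewrite /Defs.turn /= Ef.
  - by rewrite (@chosen_rcons _ [::]) // chosen_nil first_turn Ef.
  - by exists v; rewrite (_ : [set y in [:: x0]] = [set x0]) //; apply/setP => y; rewrite !inE.
have [v vA] := AS Ef.
have : 2 < size p by rewrite sp; apply: leq_trans (max_card (mem (A v))).
case: p up sp fp win pfx => [|x1 [|x2 [|x3 q]]] // up sp fp win pfx _.
apply: (win [::] x1 x2 x3).
- exact: (pfx _ q).
- by rewrite first_turn.
- exact: chosen_nil.
- by exists v; rewrite (_ : [set y in [::]] = set0) ?setD0 //; apply/setP => y; rewrite !inE.
Qed.

End Games.

(** * The blocks of a tree *)

Section Blocks.
Variables (T : finType) (e : rel T).
Hypotheses (tree_e : is_tree e) (has_major : exists v, major e v).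
Implicit Types (i j l v w x y z : T) (W : {set T}).

Local Notation leg := (leg e).

Definition leaves : {set T} := [set l | deg e l == 1].

(** The major vertex of a leaf; the default [l] never arises for leaves. *)
Definition top l : T := odflt l [pick v | terminal e l v].

Lemma top_terminal l : l \in leaves -> terminal e l (top l).
Proof.
rewrite inE => /eqP dl; rewrite /top; case: pickP => //= nt.
by have [v] := exists_terminal tree_e has_major dl; rewrite nt.
Qed.

Lemma terminal_leaf l v : terminal e l v -> l \in leaves.
Proof. by case/and3P=> dl _ _; rewrite inE. Qed.

Lemma terminal_top l v : terminal e l v -> top l = v.
Proof.
by move=> t; exact: terminal_inj (top_terminal (terminal_leaf t)) t.
Qed.

Lemma terminal_ext_major l v : terminal e l v -> v \in ext_major e.
Proof.
move=> t; rewrite inE; case/and3P: (t) => _ -> _ /=.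
by apply/card_gt0P; exists l; rewrite inE.
Qed.

Lemma leg_leaf_uniq l l' v v' x : terminal e l v -> terminal e l' v' ->
  x \in leg l v -> x \in leg l' v' -> l = l'.
Proof.
move=> t t' xl xl'; apply/eqP; apply/negPn/negP => ll'.
by have /pred0P/(_ x) /= := leg_disjoint tree_e t t' ll'; rewrite xl xl'.
Qed.

(** One of two distinct vertices lies in [W], and it alone has distance zero to itself. *)
Lemma resolving_card W : #|~: W| <= 1 -> resolving e W.
Proof.
move=> cW; apply/forallP => x; apply/forallP => y; apply/implyP => xy.
apply/exists_inP; have [xW|xW] := boolP (x \in W).
  by exists x => //; rewrite distxx // eq_sym dist_eq0 // eq_sym.
exists y; last by rewrite distxx // dist_eq0.
apply: contraTT xy => yW; rewrite negbK; apply/eqP.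
by apply: (card_le1_eqP cW); rewrite inE.
Qed.

Lemma metric_dim_eq W : resolving e W ->
  (forall W', resolving e W' -> #|W| <= #|W'|) -> metric_dim e = #|W|.
Proof.
move=> resW minW; rewrite /metric_dim; case: arg_minnP.
  by apply: resolving_card; rewrite setCT cards0.
by move=> W' resW' min'; apply/eqP; rewrite eqn_leq minW // min'.
Qed.

(* Distinct missed legs have distinct tops, and W contains a vertex of every
   other leg. *)
Lemma resolving_card_ge W : resolving e W -> leaf_num e - ex_num e <= #|W|.
Proof.
move=> resW; pose missed := [set l in leaves | [disjoint W & leg l (top l)]].
have le_missed : #|missed| <= ex_num e.
  rewrite -(@card_in_imset _ _ top) => [|l l'].
    apply/subset_leq_card/subsetP => _ /imsetP[l + ->].
    by case/setIdP=> /top_terminal/terminal_ext_major.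
  case/setIdP=> /top_terminal t Wl /setIdP[/top_terminal t' Wl'] E.
  rewrite -E in t' Wl'; apply/eqP; apply/negPn/negP => ll'.
  have [z zW] := resolving_meets_legs tree_e resW t t' ll'.
  move/pred0P/(_ z): Wl; move/pred0P/(_ z): Wl'; rewrite /= zW in_setU /=.
  by move=> -> ->.
have le_hit : #|leaves :\: missed| <= #|W|.
  pose f l := odflt l [pick z | (z \in W) && (z \in leg l (top l))].
  have fP l : l \in leaves :\: missed ->
      [/\ l \in leaves, f l \in W & f l \in leg l (top l)].
    rewrite in_setD => /andP[+ lL]; rewrite inE lL => /pred0Pn[z zP].
    by rewrite /f; case: pickP => [y /andP[]//|/(_ z)]; rewrite [_ && _]zP.
  rewrite -(@card_in_imset _ _ f) => [|l l' /fP[lL _ fl] /fP[lL' _ fl'] E].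
    by apply/subset_leq_card/subsetP => _ /imsetP[l /fP[_ fW _] ->].
  rewrite -E in fl'.
  exact: leg_leaf_uniq (top_terminal lL) (top_terminal lL') fl fl'.
rewrite leq_subLR; apply: leq_trans (leq_add le_missed le_hit).
rewrite -[leaf_num e]/#|leaves| -(cardsID missed leaves); apply: leq_add; last by [].
by apply: subset_leq_card; exact: subsetIr.
Qed.

(** This is $N(v)\cap L_v$, the legs of length one at [v]. *)
Definition close v : {set T} := nbh e v :&: term_set e v.

Lemma closeE v l : (l \in close v) = e v l && terminal e l v.
Proof. by rewrite !inE. Qed.

Lemma close_twins v x y W : x \in close v -> y \in close v -> x != y ->
  resolving e W -> (x \in W) || (y \in W).
Proof.
rewrite !closeE => /andP[ex tx] /andP[ey ty] xy resW.
have [z zW] := resolving_meets_legs tree_e resW tx ty xy.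
rewrite (leg_adjacent tree_e ex) (leg_adjacent tree_e ey) !inE.
by case/orP=> /eqP <-; rewrite zW ?orbT.
Qed.

Lemma close_disjoint v w x : x \in close v -> x \in close w -> v = w.
Proof. by rewrite !closeE => /andP[_ tv] /andP[_ tw]; exact: terminal_inj tv tw. Qed.

Lemma close_ext_major2 v : 1 < #|close v| -> v \in ext_major2 e.
Proof.
move=> c2; have /card_gt0P[l] := ltnW c2; rewrite closeE => /andP[_ t].
rewrite inE (terminal_ext_major t); apply: leq_trans c2 _.
by apply: subset_leq_card; exact: subsetIr.
Qed.

(* The block of mate v also contains the leg of spare v: it is enough that
   Resolver meets one of the two.  Without a second leaf adjacent to v, mate v
   is the junk value v, which is the index of no block. *)
Definition spare v : T :=
  if [pick l in close v] is Some l then l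
  else odflt v [pick l in term_set e v].

Definition mate v : T := odflt v [pick l in close v :\ spare v].

Lemma spare_terminal v : v \in ext_major e -> terminal e (spare v) v.
Proof.
rewrite inE /spare => /andP[_ /card_gt0P[l lv]].
case: pickP => [x|_]; first by rewrite closeE => /andP[].
by case: pickP => [x|/(_ l)]; [rewrite inE | rewrite lv].
Qed.

Lemma spare_close v l : l \in close v -> spare v \in close v.
Proof. by rewrite /spare; case: pickP => // /(_ l) ->. Qed.

Lemma mate_close v l : l \in close v -> l != spare v ->
  mate v \in close v :\ spare v.
Proof.
by move=> lc ls; rewrite /mate; case: pickP => // /(_ l); rewrite in_setD1 ls lc.
Qed.

(** * Blocks for the leaves that are not spared *)

Definition block_index : {set T} := leaves :\: spare @: ext_major e.

Definition block l : {set T} :=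
  leg l (top l) :|: (if l == mate (top l) then leg (spare (top l)) (top l) else set0).

Lemma card_block_index : #|block_index| = leaf_num e - ex_num e.
Proof.
rewrite cardsD; congr (_ - _).
have /setIidPr -> : spare @: ext_major e \subset leaves.
  by apply/subsetP => _ /imsetP[v /spare_terminal/terminal_leaf ? ->].
apply: card_in_imset => v w /spare_terminal tv /spare_terminal tw E.
by rewrite E in tv; exact: terminal_inj tv tw.
Qed.

Lemma block_index_leaf i : i \in block_index -> i \in leaves.
Proof. by rewrite inE => /andP[]. Qed.

Lemma block_index_terminal i : i \in block_index -> terminal e i (top i).
Proof. by move/block_index_leaf; exact: top_terminal. Qed.

Lemma block_index_spare i v : i \in block_index -> v \in ext_major e ->
  i != spare v.
Proof.
by rewrite inE => /andP[+ _] vM; apply: contraNneq => ->; exact: imset_f.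
Qed.

Lemma terminal_block_index l v :
  terminal e l v -> l != spare v -> l \in block_index.
Proof.
move=> t ls; rewrite inE (terminal_leaf t) andbT.
apply: contra ls => /imsetP[w /spare_terminal tw E].
by rewrite -E in tw; rewrite -(terminal_inj tw t) -E.
Qed.

Lemma in_block i x : i \in block_index -> x \in block i ->
  exists l, [/\ terminal e l (top i), x \in leg l (top i)
              & l = i \/ i = mate (top i) /\ l = spare (top i)].
Proof.
move=> iI; have ti := block_index_terminal iI.
rewrite in_setU => /orP[xi|]; first by exists i; split=> //; left.
case: eqP => [E xs|]; last by rewrite in_set0.
exists (spare (top i)); split=> //; last by right.
by apply: spare_terminal; exact: terminal_ext_major ti.
Qed.

(** A vertex lies on one leg only. The leg of a spared leaf belongs at most to the block of the
    mate, and spared leaves are not indices. *)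
Lemma block_disjoint :
  {in block_index &, forall i j, i != j -> [disjoint block i & block j]}.
Proof.
move=> i j iI jI ij; apply/pred0P => x /=; apply/negP => /andP[xi xj].
have ei := terminal_ext_major (block_index_terminal iI).
have ej := terminal_ext_major (block_index_terminal jI).
have [l [tl xl Ei]] := in_block iI xi; have [l' [tl' xl' Ej]] := in_block jI xj.
have E := leg_leaf_uniq tl tl' xl xl'; rewrite -{l'}E in tl' xl' Ej.
have Et := terminal_inj tl tl'.
case: Ei Ej => [-> [Ej|[_ Ej]]|[Ei Es] [Ej|[Ej _]]].
- by rewrite Ej eqxx in ij.
- by have := block_index_spare iI ej; rewrite -Ej eqxx.
- by have := block_index_spare jI ei; rewrite -Es -Ej eqxx.
- by rewrite Ei Ej Et eqxx in ij.
Qed.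

(** Of two legs at [v], consider those not spared. Meeting such a block means meeting its own leg
    or, for the mate, the spared leg; if neither leg is spared, only one of them can be the
    mate's. *)
Lemma block_resolving W :
  {in block_index, forall i, exists2 x, x \in W & x \in block i} ->
  resolving e W.
Proof.
move=> hitW; apply: (meets_legs_resolving tree_e has_major) => v l1 l2 t1 t2 l12.
have hit l : terminal e l v -> l != spare v -> exists2 z, z \in W &
    (z \in leg l v) || (l == mate v) && (z \in leg (spare v) v).
  move=> t ls; have [z zW zl] := hitW l (terminal_block_index t ls).
  exists z => //; move: zl; rewrite /block (terminal_top t) in_setU.
  by case: (l == mate v); rewrite ?in_set0.
have [E1|s1] := eqVneq l1 (spare v).
  have s2 : l2 != spare v by rewrite -E1 eq_sym.
  have [z zW zl] := hit l2 t2 s2; exists z => //; rewrite in_setU E1.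
  by case/orP: zl => [->|/andP[_ ->]]; rewrite ?orbT.
have [z zW zl] := hit l1 t1 s1.
have [E2|s2] := eqVneq l2 (spare v).
  exists z => //; rewrite in_setU E2.
  by case/orP: zl => [->|/andP[_ ->]]; rewrite ?orbT.
have [z' zW' zl'] := hit l2 t2 s2.
case/orP: zl => [zl|/andP[/eqP E1 _]]; first by exists z; rewrite // in_setU zl.
case/orP: zl' => [zl|/andP[/eqP E2 _]]; first by exists z'; rewrite // in_setU zl orbT.
by rewrite E1 E2 eqxx in l12.
Qed.

Lemma block_gt0 i : i \in block_index -> 0 < #|block i|.
Proof.
move/block_index_terminal=> t; apply/card_gt0P; exists i.
by rewrite in_setU (leaf_in_leg tree_e t).
Qed.

(** A one-vertex block is a leg of length one that was not merged, so the spared leaf and its mate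
    are also adjacent to the top and differ from [i]. *)
Lemma small_block i : i \in block_index -> #|block i| <= 1 ->
  [/\ i \in close (top i), i != spare (top i), i != mate (top i),
      spare (top i) \in close (top i) & mate (top i) \in close (top i) :\ spare (top i)].
Proof.
move=> iI; have t := block_index_terminal iI; have ext := terminal_ext_major t.
have is' := block_index_spare iI ext.
rewrite leqNgt => small.
have ic : i \in close (top i).
  rewrite closeE t andbT; apply: contraNT small => /(leg_card2 tree_e t) c2.
  by apply: leq_trans c2 (subset_leq_card _); exact: subsetUl.
split=> //; [|exact: spare_close ic|exact: mate_close ic is'].
apply: contraNneq small => im; apply/card_gt1P; exists i, (spare (top i)).
split=> //; rewrite in_setU; first by rewrite (leaf_in_leg tree_e t).
by rewrite -im eqxx (leaf_in_leg tree_e (spare_terminal ext)) orbT.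
Qed.

Lemma small_block_close i : i \in block_index -> #|block i| <= 1 ->
  2 < #|close (top i)|.
Proof.
move=> iI /(small_block iI)[ic is' im sc]; rewrite in_setD1 => /andP[ms mc].
apply/card_gt2P; exists i, (spare (top i)), (mate (top i)).
by split=> //; split=> //; rewrite eq_sym.
Qed.

Lemma small_blocks_close i j : i \in block_index -> j \in block_index ->
  #|block i| <= 1 -> #|block j| <= 1 -> top i = top j -> i != j ->
  3 < #|close (top i)|.
Proof.
move=> iI jI /(small_block iI)[ic is' im sc mc] /(small_block jI)[jc js jm _ _] E ij.
rewrite -E in jc js jm; move: mc; rewrite in_setD1 => /andP[ms mc].
have u : uniq [:: i; j; spare (top i); mate (top i)].
  by rewrite /= !inE !negb_or ij is' im js jm eq_sym ms.
rewrite -[4]/(size [:: i; j; spare (top i); mate (top i)]) -(card_uniqP u).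
by apply/subset_leq_card/subsetP => x; rewrite 4!in_cons in_nil orbF => /or4P[] /eqP->.
Qed.

(** * Winning bounds in the cases of the theorem *)

Lemma tree_card_gt0 : 0 < #|T|. Proof. by case: tree_e. Qed.

Lemma resolver_wins_within first :
  {in block_index &, forall i j, #|block i| <= 1 -> #|block j| <= 1 -> i = j} ->
  (first = Spoiler -> {in block_index, forall i, 1 < #|block i|}) ->
  wins_within e first Resolver (leaf_num e - ex_num e).
Proof.
rewrite -card_block_index => small1 small0.
apply: (blocks_wins_within tree_card_gt0 block_disjoint) => //.
- exact: block_resolving.
- exact: block_gt0.
Qed.

(** One vertex is not enough for Spoiler: its complement is resolving. *)
Lemma spoiler_moves first :
  wins_within e first Spoiler 2 -> moves_to_win e first Spoiler = Some 2.
Proof.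
move=> w2; apply: least_eq => // m lt_m /wins_within_exists[h [ch won]].
have resC : resolving e (~: chosen first Spoiler h).
  by apply: resolving_card; rewrite setCK; lia.
by have /negP := won _ resC; apply; rewrite disjoint_sym -subsets_disjoint.
Qed.

Lemma resolver_moves first k : wins_within e first Resolver k ->
  (forall W, resolving e W -> k <= #|W|) ->
  moves_to_win e first Resolver = Some k.
Proof.
move=> wk lek; apply: least_eq => // m lt_m /wins_within_exists[h [ch won]].
have := lek _ won; lia.
Qed.

Lemma close_le2_no_small_block :
  (forall v, v \in ext_major2 e -> #|close v| <= 2) ->
  {in block_index, forall i, 1 < #|block i|}.
Proof.
move=> le2 i iI; rewrite ltnNge; apply/negP => /(small_block_close iI) c3.
by have := le2 _ (close_ext_major2 (ltnW c3)); lia.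
Qed.

Lemma close_le2_resolver_wins first :
  (forall v, v \in ext_major2 e -> #|close v| <= 2) ->
  wins_within e first Resolver (leaf_num e - ex_num e).
Proof.
move=> /close_le2_no_small_block big; apply: resolver_wins_within => //.
by move=> i j /big; rewrite ltnNge => /negbTE->.
Qed.

(** One-vertex blocks occur only at [w], and two of them would give [w] four adjacent leaves. Moving
    first, Resolver can afford one. *)
Lemma close_one3_resolver_wins w : #|close w| = 3 ->
  (forall v, v \in ext_major2 e -> v <> w -> #|close v| <= 2) ->
  wins_within e Resolver Resolver (leaf_num e - ex_num e).
Proof.
move=> w3 le2; apply: resolver_wins_within => // i j iI jI si sj.
have topw k : k \in block_index -> #|block k| <= 1 -> top k = w.
  move=> kI /(small_block_close kI) c3; apply: contrapT => tw.
  by have := le2 _ (close_ext_major2 (ltnW c3)) tw; lia.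
apply/eqP; apply/negPn/negP => ij.
have := small_blocks_close iI jI si sj.
by rewrite (topw i) // (topw j) // w3 => /(_ erefl ij).
Qed.

Lemma spoiler_wins_within first :
  (first = Spoiler -> exists v, 2 < #|close v|) ->
  (first = Resolver -> forall x, exists v, 2 < #|close v :\ x|) ->
  wins_within e first Spoiler 2.
Proof. exact: classes_wins_within tree_card_gt0 close_twins. Qed.

Lemma close_ge4_spoiler_wins first v : 3 < #|close v| ->
  wins_within e first Spoiler 2.
Proof.
move=> c4; apply: spoiler_wins_within => _ => [|x]; exists v; first exact: ltnW.
by move: c4; rewrite (cardsD1 x); case: (_ \in _); lia.
Qed.

(** The two classes are disjoint, so Resolver's opening move spoils at most one. *)
Lemma close_two3_spoiler_wins first u w : u <> w -> 2 < #|close u| ->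
  2 < #|close w| -> wins_within e first Spoiler 2.
Proof.
move=> uw cu cw; apply: spoiler_wins_within => _ => [|x]; first by exists u.
have [xu|xu] := boolP (x \in close u); last first.
  by exists u; move: cu; rewrite (cardsD1 x) (negbTE xu).
exists w; move: cw; rewrite (cardsD1 x).
by have /negbTE -> : x \notin close w by apply/negP => /(close_disjoint xu).
Qed.

End Blocks.

(** * Outcomes and numbers of moves *)

Theorem theorem4p3 (T : finType) (e : rel T)
    (tree_e : is_tree e) (npath_e : ~ is_path_graph e) :
  [/\ ((exists2 v, v \in ext_major2 e & 4 <= #|nbh e v :&: term_set e v|) \/
       (exists u w, [/\ u \in ext_major2 e, w \in ext_major2 e, u <> w,
                        #|nbh e u :&: term_set e u| = 3
                      & #|nbh e w :&: term_set e w| = 3])) ->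
      has_outcome e OutcomeS,
      (exists w, [/\ w \in ext_major2 e, #|nbh e w :&: term_set e w| = 3
                   & forall v, v \in ext_major2 e -> v <> w ->
                       #|nbh e v :&: term_set e v| <= 2]) ->
      has_outcome e OutcomeN,
      (forall v, v \in ext_major2 e -> #|nbh e v :&: term_set e v| <= 2) ->
      has_outcome e OutcomeR,
      has_outcome e OutcomeS -> S_MB e = Some 2 /\ S_MB' e = Some 2
    & has_outcome e OutcomeR ->
      [/\ R_MB e = Some (metric_dim e), R_MB' e = Some (metric_dim e)
        & metric_dim e = leaf_num e - ex_num e]].
Proof.
have maj := exists_major tree_e npath_e.
set condS := (_ \/ _); set condN := (exists w, _); set condR := (forall v : T, _ -> _).
have winS : condS -> forall first, wins_within e first Spoiler 2.
  by move=> [[v _ c4]|[u [w [_ _ uw cu cw]]]] first;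
    [exact: (close_ge4_spoiler_wins tree_e first c4)
    |apply: (close_two3_spoiler_wins tree_e _ uw); rewrite /close ?cu ?cw].
have winNS : condN -> wins_within e Spoiler Spoiler 2.
  move=> [w [_ c3 _]]; apply: spoiler_wins_within => // _.
  by exists w; rewrite /close c3.
have winNR : condN -> wins_within e Resolver Resolver (leaf_num e - ex_num e).
  by move=> [w [_ c3 le2]]; exact: (close_one3_resolver_wins tree_e maj c3 le2).
have winR : condR -> forall first,
    wins_within e first Resolver (leaf_num e - ex_num e).
  by move=> le2 first; exact: (close_le2_resolver_wins tree_e maj _ le2).
(* The conditions are exhaustive, which lets an outcome be traced back to its condition. *)
have cases : [\/ condS, condN | condR].
  have [cS|nS] := pselect condS; first by constructor 1.
  have [cR|nR] := pselect condR; first by constructor 3.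
  constructor 2; have [w] : exists w, ~ (w \in ext_major2 e ->
      #|nbh e w :&: term_set e w| <= 2) by apply/existsNP.
  case/not_implyP=> wM /negP; rewrite -ltnNge => c3.
  have le3 v : v \in ext_major2 e -> #|nbh e v :&: term_set e v| <= 3.
    by move=> vM; rewrite leqNgt; apply/negP => c4; apply: nS; left; exists v.
  have w3 : #|nbh e w :&: term_set e w| = 3.
    by apply/eqP; rewrite eqn_leq le3.
  exists w; split=> // v vM vw; rewrite leqNgt; apply/negP => v3; apply: nS.
  right; exists v, w; split=> //.
  by apply/eqP; rewrite eqn_leq le3.
have RS first : has_winning_strategy e first Resolver ->
    has_winning_strategy e first Spoiler -> False by exact: winning_exclusive.
split.
- by move=> /winS w; split; exact: wins_within_winning (w _).
- move=> c; split; first exact: wins_within_winning (winNR c).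
  exact: wins_within_winning (winNS c).
- by move=> /winR w; split; exact: wins_within_winning (w _).
(* Under either other condition Resolver would win the R-game. *)
- move=> [oR _]; suff w : condS by split; apply: spoiler_moves => //; exact: winS.
  case: cases => // [/winNR w|/winR w].
    by case: (RS Resolver) => //; exact: wins_within_winning w.
  by case: (RS Resolver) => //; exact: wins_within_winning (w _).
(* Under either other condition Spoiler would win the S-game. *)
- move=> [_ oS]; have c : condR.
    case: cases => // [/winS w|/winNS w].
      by case: (RS Spoiler) => //; exact: wins_within_winning (w _).
    by case: (RS Spoiler) => //; exact: wins_within_winning w.
  (* Resolver's vertices in a winning history form a resolving set that attains the lower bound. *)
  have [h [ch resh]] := wins_within_exists (winR c Resolver).
  have lb := resolving_card_ge tree_e maj.
  have dimE : metric_dim e = leaf_num e - ex_num e.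
    rewrite (metric_dim_eq tree_e resh) => [|W /lb]; last exact: leq_trans.
    by apply/eqP; rewrite eqn_leq ch lb.
  by rewrite dimE; split=> //; apply: resolver_moves => //; exact: winR.
Qed.
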